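(* Let $R$ be an associative ring with identity and let $a,b\in R$. If $1-ab$ is strongly clean in $R$, then $1-ba$ is strongly clean in $R$.
   Context: $U(R)$ denotes the group of units of $R$. An element $x\in R$ is strongly clean if there exists an idempotent $e^2=e\in R$ with $ex=xe$ and $x-e\in U(R)$. *)

(* Defs.v *)
From HB Require Import structures.
From mathcomp Require Import all_boot all_algebra.
Set Implicit Arguments.
Unset Strict Implicit.
Unset Printing Implicit Defensive.
Import GRing.Theory.
Local Open Scope ring_scope.

(* [GRing.unit] is only available on a [unitRingType], i.e. a nontrivial ring
   with a decidable invertibility predicate; for an arbitrary ring,
   membership in U(R) is stated as the existence of a two-sided inverse. *)
Definition is_unit (R : pzRingType) (x : R) : Prop :=
  exists y : R, y * x = 1 /\ x * y = 1.

Definition strongly_clean (R : pzRingType) (x : R) : Prop :=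
  exists e : R, [/\ e ^+ 2 = e, e * x = x * e & is_unit (x - e)].

(* Main.v *)
Require Import Defs.
From mathcomp Require Import all_boot all_algebra.
Import GRing.Theory.
Local Open Scope ring_scope.

(**
  Put c = ab, and let e be an idempotent commuting with c such that 1 - c - e
  has an inverse y.  On the corner eRe the element c is invertible, with
  inverse w = - e y, and w transports e to the idempotent e' = b w a, which
  commutes with ba.  Moreover 1 - ba - e' = 1 - b (1 + w) a is inverted by
  1 + b (y - e y^2) a, as in Jacobson's lemma.
*)

(** The inverse is [1 + b * t * a]: each product with it is 1 plus [b * r * a], where [r] vanishes
    by one of the two equations. Jacobson's lemma is the case [s = 1]. *)
Lemma is_unit_1sub_mul (R : pzRingType) (a b s t : R) :
    t = s + s * (a * b) * t -> t = s + t * (a * b) * s ->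
  is_unit (1 - b * s * a).
Proof.
move=> tE tE'; exists (1 + b * t * a); split.
- rewrite mulrBr mulr1 mulrDl mul1r {1}tE'.
  by rewrite !(mulrDl, mulrDr) !mulrA addrK.
- rewrite mulrBl mul1r mulrDr mulr1 {1}tE.
  by rewrite !(mulrDl, mulrDr) !mulrA addrK.
Qed.

Theorem corollary2p6 (R : pzRingType) (a b : R)
  (hab : strongly_clean (1 - a * b)) : strongly_clean (1 - b * a).
Proof.
have [e [ee ex [y [yu uy]]]] := hab; rewrite expr2 in ee.
set c := a * b in ex yu uy.
have ec : e * c = c * e.
  by move: ex; rewrite mulrBr mulrBl mulr1 mul1r => /addrI /oppr_inj.
have eu : e * (1 - c - e) = (1 - c - e) * e by rewrite mulrBr mulrBl ex.
have ey : e * y = y * e.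
  by rewrite -[LHS]mul1r -yu -mulrA (mulrA _ e) -eu -!mulrA uy mulr1.
(* Solve [(1 - c - e) * y = 1] for [c * y]; a further factor [e] then leaves only [- e]. *)
have cy : c * y = y - e * y - 1.
  by rewrite -[X in _ - X]uy !mulrBl mul1r [X in _ - X]addrAC subKr.
have yc : y * c = y - e * y - 1.
  by rewrite -[X in _ - X]yu !mulrBr mulr1 ey [X in _ - X]addrAC subKr.
have cey : c * (e * y) = - e.
  by rewrite mulrA -ec -mulrA cy !mulrBr mulr1 mulrA ee subrr sub0r.
have eyc : e * y * c = - e.
  by rewrite -mulrA yc !mulrBr mulr1 mulrA ee subrr sub0r.
exists (- (b * (e * y) * a)); split.
- rewrite expr2 mulrNN.
  transitivity (b * (e * y * (c * (e * y))) * a); first by rewrite /c !mulrA.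
  by rewrite cey mulrN -(mulrA e) -ey (mulrA e) ee mulrN mulNr.
(* Both products with [b * a] reduce to [b * e * a], as [e * y * c] and [c * (e * y)] are both
   [- e]. *)
- rewrite mulrBr mulrBl mulr1 mul1r; congr (_ - _).
  rewrite mulNr mulrN; congr (- _).
  transitivity (b * (e * y * c) * a); first by rewrite /c !mulrA.
  by rewrite eyc -cey /c !mulrA.
have -> : 1 - b * a - - (b * (e * y) * a) = 1 - b * (1 - e * y) * a.
  by rewrite mulrBr mulr1 mulrBl opprB opprK addrA addrAC.
have tE : y - e * y * y = (1 - e * y) * y by rewrite mulrBl mul1r.
have tE' : y - e * y * y = y * (1 - e * y) by rewrite mulrBr mulr1 mulrA ey.
(* Here [s = 1 - e * y] and [t = s * y = y * s]. Both [c * t] and [t * c] equal [y - 1], so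
   [s + s * (y - 1) = t], and likewise on the other side. *)
apply: (@is_unit_1sub_mul _ _ _ _ (y - e * y * y)); rewrite -/c.
- have ct : c * (y - e * y * y) = y - 1.
    by rewrite mulrBr mulrA cey cy mulNr opprK addrAC subrK.
  by rewrite -(mulrA _ c) ct mulrBr mulr1 tE [RHS]addrC subrK.
- have tc : (y - e * y * y) * c = y - 1.
    by rewrite tE' -(mulrA y) mulrBl mul1r eyc opprK mulrDr yc -ey addrAC subrK.
  by rewrite tc mulrBl mul1r tE' [RHS]addrC subrK.
Qed.
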